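(* The set of (Gödel numbers of) all triples $(D,\circ,n)$ satisfying the following three conditions is $\Pi^0_2$-complete (it belongs to $\Pi^0_2$ and every $\Pi^0_2$ subset of $\mathbb{N}$ is many-one reducible to it): (i) $\varphi_n$ is a total function with $\varphi_n(x+1)\ge\varphi_n(x)>x$ for all $x$, whose profile $\mathsf{prof}_{\varphi_n}$ is total, i.e. $\mathsf{prof}_{\varphi_n}(r)<\infty$ for all $r\ge1$; (ii) $D$ is a finite subset of $\mathbb{N}$, $\circ$ is a partial binary operation on $D$, and the functions $\varphi_k$, $k\in D$, are permutations of $\mathbb{N}$ forming a $\varphi_n$-chunk $E=\{\varphi_k:k\in D\}$ of $S(\omega)$ which realizes $(D,\circ)$ with respect to the map $\varphi_k\mapsto k$; (iii) the chunk $(D,\circ)$ is sofic under approximations by supp-morphisms, i.e. for every $r>1$ there are $N$ and a supp-morphism $\sigma:E\to S_N$ such that $k\mapsto\sigma(\varphi_k)$ is a $(1-r^{-1})$-expansive $r^{-1}$-morphism from $(D,\circ)$ to $S_N$.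
   Context: $\varphi(x,y)$ is a universal partial computable function, $\varphi_k(x)=\varphi(k,x)$; finite objects are identified with their Gödel numbers. For $g,h\in S_N$, $d_H(g,h)=1-\frac{|\mathsf{Fix}(g^{-1}h)|}{N}$. A chunk of a group is a finite subset containing $1$, viewed as a partial group (product defined when it lies in the chunk). A map $f:E_1\to E_2$ between chunks (or partial structures with unit) is a homomorphism if it preserves the unit and $f(xy)=f(x)f(y)$ whenever the product $xy$ is defined in $E_1$; if it is bijective, $E_1$ realizes $E_2$. For $0<\varepsilon<1$, a map $f$ from a chunk (or partial structure with unit) to $S_N$ is an $\varepsilon$-morphism if $f(1)=1$ and $d_H(f(xy),f(x)f(y))\le\varepsilon$ whenever $xy$ is defined; it is $(1-\varepsilon)$-expansive if $d_H(f(x),f(y))\ge1-\varepsilon$ for distinct $x,y$. For a function $g$ with $g(x+1)\ge g(x)>x$, $\mathsf{prof}_g(r)=\inf\{N\in\mathbb{N}:\exists m\,(g(m)\le N\wedge\frac{N-m}{N}<r^{-1})\}$, $r\ge1$. $S(\omega)$ is the group of permutations of $\mathbb{N}$; a permutation $\rho$ is bounded by $g$ if $\rho(m)\le g(x)$ whenever $m\le x$; a chunk of $S(\omega)$ is a $g$-chunk if all its elements are bounded by $g$. Identifying $S_N$ with the permutations of $\{1,\dots,N\}$, a supp-morphism $\sigma:E\to S_N$ is a map with $\sigma(1)=1$ such that $\sigma(\rho)(m)=\rho(m)$ for all $\rho\in E$ and all $m\le N$ with $\rho(m)\le N$. *)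

(* Defs.v *)
From HB Require Import structures.
From mathcomp Require Import all_boot all_order all_algebra all_fingroup.
From mathcomp Require Import finmap.
From mathcomp Require Import boolp classical_sets functions cardinality.
From mathcomp Require Import reals ereal.

Set Implicit Arguments.
Unset Strict Implicit.
Unset Printing Implicit Defensive.

Import Order.TTheory GRing.Theory Num.Theory.

Local Open Scope classical_set_scope.

(* Kleene's definition schemes of the n-ary partial computable functions. *)
Inductive recf : nat -> Type :=
| RZero n : recf n
| RSucc : recf 1
| RProj n (i : 'I_n) : recf n
| RComp m n (f : recf m) (h : 'I_m -> recf n) : recf n
| RPrim n (f : recf n) (h : recf n.+2) : recf n.+1
| RMu n (f : recf n.+1) : recf n.

(* ev f v y : the partial function f is defined at v, with value y. *)
Fixpoint ev n (f : recf n) : n.-tuple nat -> nat -> Prop :=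
  match f in recf n return n.-tuple nat -> nat -> Prop with
  | RZero _ => fun _ y => y = 0
  | RSucc => fun v y => y = (thead v).+1
  | RProj _ i => fun v y => y = tnth v i
  | RComp m _ f h => fun v y =>
      exists w : m.-tuple nat, (forall i, ev (h i) v (tnth w i)) /\ ev f w y
  | RPrim n f h => fun v y =>
      let a : n.-tuple nat := behead_tuple v in
      exists s : nat -> nat,
        [/\ ev f a (s 0),
            forall i, i < thead v -> ev h (cons_tuple i (cons_tuple (s i) a)) (s i.+1)
          & y = s (thead v)]
  | RMu _ f => fun v y =>
      ev f (cons_tuple y v) 0 /\
      forall i, i < y -> exists k, ev f (cons_tuple i v) k.+1
  end.

Definition computable_fun (h : nat -> nat) : Prop :=
  exists c : recf 1, forall x, ev c [tuple x] (h x).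

Definition computable_rel3 (Q : nat -> nat -> nat -> bool) : Prop :=
  exists c : recf 3, forall x y z, ev c [tuple x; y; z] (Q x y z : nat).

(* Universality in the sense of Goedel numberings: a parameter of any binary
   partial computable function can be computably turned into an index. *)
Definition universal (phi : recf 2) : Prop :=
  forall f : recf 2, exists2 s : nat -> nat, computable_fun s &
    forall x y z, ev f [tuple x; y] z <-> ev phi [tuple s x; y] z.

(* phi_k is total and equal to h *)
Definition computes (phi : recf 2) (k : nat) (h : nat -> nat) : Prop :=
  forall x, ev phi [tuple k; x] (h x).

Definition Pi02 (A : set nat) : Prop :=
  exists2 Q : nat -> nat -> nat -> bool, computable_rel3 Q &
    forall x, A x <-> forall y, exists z, Q x y z.

Definition many_one_reducible (B A : set nat) : Prop :=
  exists2 h : nat -> nat, computable_fun h & forall x, B x <-> A (h x).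

Definition Pi02_complete (A : set nat) : Prop :=
  Pi02 A /\ forall B : set nat, Pi02 B -> many_one_reducible B A.

(* Canonical index of a finite set of naturals: bit k is set iff k is in D. *)
Definition godel_fset (D : {fset nat}) : nat := \sum_(k <- D) 2 ^ k.

(* Canonical index of the graph of a finite partial binary operation. *)
Definition godel_op (op : {fmap nat * nat -> nat}) : nat :=
  \sum_(p : domf op) 2 ^ CodeSeq.code [:: (val p).1; (val p).2; op p].

Definition godel_triple (D : {fset nat}) (op : {fmap nat * nat -> nat})
    (n : nat) : nat :=
  CodeSeq.code [:: godel_fset D; godel_op op; n].

(* The product of permutations in functional order, (s t)(i) = s (t i);
   the library's product composes in the opposite order. *)
Definition pmulS N (s t : 'S_N) : 'S_N := (t * s)%g.

Definition dH (R : realType) N (s t : 'S_N) : R :=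
  (1 - #|[pred i : 'I_N | pmulS s^-1%g t i == i]|%:R / N%:R)%R.

(* Partial structures with unit; pmul x y z : the product x y is defined and
   equal to z. *)
Record pstruct : Type := PStruct {
  psort :> Type;
  pset : set psort;
  pone : psort;
  pmul : psort -> psort -> psort -> Prop }.

Definition pstruct_hom (S1 S2 : pstruct) (f : S1 -> S2) : Prop :=
  f (pone S1) = pone S2 /\
  forall x y z : S1, pmul x y z -> pmul (f x) (f y) (f z).

Definition realizes (S1 S2 : pstruct) (f : S1 -> S2) : Prop :=
  pstruct_hom f /\ set_bij (@pset S1) (@pset S2) f.

Definition eps_morphism (R : realType) (eps : R) (S : pstruct) N
    (f : S -> 'S_N) : Prop :=
  f (pone S) = 1%g /\
  forall x y z : S, pmul x y z -> (dH R (f z) (pmulS (f x) (f y)) <= eps)%R.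

Definition expansive (R : realType) (c : R) (S : pstruct) N
    (f : S -> 'S_N) : Prop :=
  forall x y : S, pset x -> pset y -> x <> y -> (c <= dH R (f x) (f y))%R.

Definition growth_fun (g : nat -> nat) : Prop :=
  forall x, g x <= g x.+1 /\ x < g x.

(* Takes the value +oo when no N qualifies. *)
Definition prof (R : realType) (g : nat -> nat) (r : R) : \bar R :=
  ereal_inf [set (N%:R : R)%:E | N in
    [set N : nat | exists m : nat,
       g m <= N /\ ((N%:R - m%:R) / N%:R < r^-1 :> R)%R]].

Definition bounded_by (g rho : nat -> nat) : Prop :=
  forall x m, m <= x -> rho m <= g x.

Definition is_chunk (E : set (nat -> nat)) : Prop :=
  [/\ finite_set E, E id & forall rho, E rho -> bijective rho].

Definition is_g_chunk (g : nat -> nat) (E : set (nat -> nat)) : Prop :=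
  is_chunk E /\ forall rho, E rho -> bounded_by g rho.

Definition chunk_pstruct (E : set (nat -> nat)) : pstruct :=
  @PStruct (nat -> nat) E id
    (fun rho tau pi => [/\ E rho, E tau, E pi & pi = rho \o tau]).

Definition partial_op_on (D : {fset nat}) (op : {fmap nat * nat -> nat}) : Prop :=
  forall x y z, op.[? (x, y)]%fmap = Some z -> [/\ x \in D, y \in D & z \in D].

Definition op_unit (D : {fset nat}) (op : {fmap nat * nat -> nat}) (e : nat) : Prop :=
  e \in D /\ forall x, x \in D ->
    op.[? (e, x)]%fmap = Some x /\ op.[? (x, e)]%fmap = Some x.

Definition op_pstruct (D : {fset nat}) (op : {fmap nat * nat -> nat}) (e : nat) : pstruct :=
  @PStruct nat [set k | k \in D] e
    (fun x y z => op.[? (x, y)]%fmap = Some z).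

(* The points 1, ..., N on which S_N acts are represented by i.+1, i : 'I_N;
   the point 0 lies outside all of them. *)
Definition supp_morphism (E : set (nat -> nat)) N (sigma : (nat -> nat) -> 'S_N) : Prop :=
  sigma id = 1%g /\
  forall rho, E rho -> forall i j : 'I_N, rho i.+1 = j.+1 -> sigma rho i = j.

(* g stands for phi_n, p k for phi_k (k in D), f for the map phi_k |-> k, and e
   for the unit of (D, op). *)
Definition supp_sofic_triple (R : realType) (phi : recf 2) (D : {fset nat})
    (op : {fmap nat * nat -> nat}) (n : nat) : Prop :=
  exists (g : nat -> nat) (p : nat -> nat -> nat)
         (f : (nat -> nat) -> nat) (e : nat),
  let E := [set p k | k in [set k | k \in D]] in
  [/\ [/\ computes phi n g, growth_fun g
        & forall r : R, (1 <= r)%R -> (prof g r < +oo)%E],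
      [/\ partial_op_on D op /\ op_unit D op e,
          forall k, k \in D -> computes phi k (p k),
          is_g_chunk g E,
          forall k, k \in D -> f (p k) = k
        & realizes (f : chunk_pstruct E -> op_pstruct D op e)]
    & forall r : R, (1 < r)%R ->
        exists (N : nat) (sigma : (nat -> nat) -> 'S_N),
        let h : op_pstruct D op e -> 'S_N := fun k => sigma (p k) in
        [/\ 0 < N, supp_morphism E sigma,
            expansive (1 - r^-1)%R h & eps_morphism (r^-1)%R h]].

(* Main.v *)
Require Import Defs.
From mathcomp Require Import all_boot all_order all_algebra all_fingroup finmap.
From mathcomp Require Import boolp classical_sets cardinality reals ereal.
From mathcomp Require Import zify.

(** Membership in Pi^0_2.  Since [phi] is one fixed scheme, its graph is shown
    to be Sigma^0_1 by induction on [recf], with no universal machine: finite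
    computation histories are coded by iterated Cantor pairing.  Given totality,
    a statement about values of the functions [phi_k] may be read
    existentially ("there is [y] with [phi_k(x) = y] such that ..."), so that
    each of the conditions (i)-(iii) has the form [forall y, Sigma^0_1].  Real
    thresholds [r] are replaced by natural ones, and a supp-morphism by a
    finite table of permutations of [{1, ..., N}].

    Hardness.  For [B = {x | forall y, exists z, Q x y z}] take the trivial
    chunk [{id}] and the partial function [g_x(y) = y + 1] if some [z]
    satisfies [Q x y z], undefined otherwise.  If [g_x] is total it is the
    successor function, whose profile is total, and it is total iff [x] is in
    [B]. *)

Set Implicit Arguments.
Unset Strict Implicit.
Unset Printing Implicit Defensive.

(** * Computable functions *)

(** [F] lives on lists of any length, so composition needs no casts between tuple types; [cfun n F]
    constrains it on lists of length [n] only. *)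
Definition cfun n (F : seq nat -> nat) : Prop :=
  exists c : recf n, forall v : n.-tuple nat, ev c v (F v).

Lemma cfun_ext n F G : F =1 G -> cfun n F -> cfun n G.
Proof. by move=> eFG [c hc]; exists c => v; rewrite -eFG. Qed.

Lemma cfun_proj n i : i < n -> cfun n (fun v => nth 0 v i).
Proof.
move=> lt_in; exists (RProj (Ordinal lt_in)) => v.
by rewrite /= (tnth_nth 0).
Qed.

Lemma cfun_comp n F (Gs : seq (seq nat -> nat)) :
    cfun (size Gs) F ->
    (forall i, i < size Gs -> cfun n (nth (fun=> 0) Gs i)) ->
  cfun n (fun v => F [seq G v | G <- Gs]).
Proof.
move=> [c hc] hG.
have /fin_all_exists[cs hcs] : forall i : 'I_(size Gs), exists ci : recf n,
    forall v : n.-tuple nat, ev ci v (nth (fun=> 0) Gs i v).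
  by move=> i; exact: hG.
exists (RComp c cs) => v /=; exists (map_tuple (fun G : seq nat -> nat => G v) (in_tuple Gs)).
split=> [i|]; last exact: hc.
rewrite (tnth_nth 0) /= (nth_map (fun=> 0)) //; exact: hcs.
Qed.

Lemma cfun1P f : computable_fun f <-> cfun 1 (fun v => f (nth 0 v 0)).
Proof.
split=> [[c hc]|[c hc]]; exists c => v; last exact: hc [tuple v].
by rewrite (_ : v = [tuple nth 0 v 0]) //; apply/val_inj; case: v => [[|x []]].
Qed.

Lemma cfun_app1 n f G : computable_fun f -> cfun n G -> cfun n (fun v => f (G v)).
Proof. by move=> /cfun1P hf hG; apply: (cfun_comp (Gs := [:: G]) hf); case. Qed.

Lemma cfun_app2 n f G H : cfun 2 (fun v => f (nth 0 v 0) (nth 0 v 1)) ->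
  cfun n G -> cfun n H -> cfun n (fun v => f (G v) (H v)).
Proof.
by move=> hf hG hH; apply: (cfun_comp (Gs := [:: G; H]) hf); case=> [|[]].
Qed.

Lemma cfun_const n k : cfun n (fun=> k).
Proof.
elim: k => [|k IHk]; first by exists (RZero n).
by apply: (cfun_app1 (f := succn)) => //; exists RSucc.
Qed.

Lemma cfun_succ n G : cfun n G -> cfun n (fun v => (G v).+1).
Proof. by apply: cfun_app1; exists RSucc. Qed.

(** [RPrim] recurses on its first argument, with the others as parameters. Recursion up to [N v]
    with parameters [v] is such a function composed with [N] and the [n] projections. *)
Lemma cfun_rec n N F H : cfun n N -> cfun n F -> cfun n.+2 H ->
  cfun n (fun v =>
    nat_rec (fun=> nat) (F v) (fun i r => H [:: i, r & v]) (N v)).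
Proof.
move=> hN [c hc] [d hd].
pose P v := nat_rec (fun=> nat) (F (behead v))
  (fun i r => H [:: i, r & behead v]) (head 0 v).
have hP : cfun n.+1 P.
  exists (RPrim c d) => v /=.
  exists (fun k => nat_rec (fun=> nat) (F (behead v))
    (fun i r => H [:: i, r & behead v]) k).
  split; [exact: hc | by move=> i _; exact: hd | ].
  by rewrite /P; case/tupleP: v => x v; rewrite theadE.
pose Gs := N :: [seq (fun v => nth 0 v i) | i <- iota 0 n].
have sGs : size Gs = n.+1 by rewrite /= size_map size_iota.
rewrite -sGs in hP; have := cfun_comp (n := n) hP.
rewrite sGs => /(_ _)[|c' hc']; last first.
  exists c' => v; have := hc' v; rewrite /P /=.
  rewrite -map_comp (_ : map _ _ = v) //.
  by apply: (@eq_from_nth _ 0); rewrite size_map size_iota ?size_tuple // => i lt_in;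
     rewrite (nth_map 0) ?size_iota //= nth_iota.
case=> [|i] //= lt_in.
by rewrite (nth_map 0) ?size_iota // nth_iota //; apply: cfun_proj.
Qed.

Lemma cfun_add n G H : cfun n G -> cfun n H -> cfun n (fun v => G v + H v).
Proof.
apply: (cfun_app2 (f := addn)).
(* In [[:: i, r & v]] position 1 holds the previous value [r]. *)
pose A v := nat_rec (fun=> nat) (nth 0 v 1) (fun i r => (nth 0 [:: i, r & v] 1).+1)
  (nth 0 v 0).
apply: (cfun_ext (F := A)) => [v|].
  by rewrite /A; elim: (nth 0 v 0) => //= k ->.
by apply: (cfun_rec (H := fun v => (nth 0 v 1).+1)); try apply: cfun_succ;
   apply: cfun_proj.
Qed.

Lemma cfun_pred n G : cfun n G -> cfun n (fun v => (G v).-1).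
Proof.
apply: (cfun_app1 (f := predn)); apply/cfun1P.
pose A v := nat_rec (fun=> nat) 0 (fun i r => (nth 0 [:: i, r & v] 0)) (nth 0 v 0).
apply: (cfun_ext (F := A)) => [v|]; first by rewrite /A; case: (nth 0 v 0).
by apply: (cfun_rec (F := fun=> 0) (H := fun v => (nth 0 v 0)));
   try apply: cfun_const; apply: cfun_proj.
Qed.

Lemma cfun_sub n G H : cfun n G -> cfun n H -> cfun n (fun v => G v - H v).
Proof.
apply: (cfun_app2 (f := subn)).
pose A v := nat_rec (fun=> nat) (nth 0 v 0) (fun i r => (nth 0 [:: i, r & v] 1).-1)
  (nth 0 v 1).
apply: (cfun_ext (F := A)) => [v|].
  by rewrite /A; elim: (nth 0 v 1) => [|k /= ->]; rewrite ?subn0 // subnS.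
by apply: (cfun_rec (H := fun v => (nth 0 v 1).-1)); try apply: cfun_pred;
   apply: cfun_proj.
Qed.

(** * Cantor pairing *)

Definition tri n := nat_rec (fun=> nat) 0 (fun i r => r + i.+1) n.

Lemma cfun_tri n G : cfun n G -> cfun n (fun v => tri (G v)).
Proof.
apply: (cfun_app1 (f := tri)); apply/cfun1P.
apply: (cfun_rec (F := fun=> 0) (H := fun v => nth 0 v 1 + (nth 0 v 0).+1)).
- exact: cfun_proj.
- exact: cfun_const.
- by apply: cfun_add; [|apply: cfun_succ]; apply: cfun_proj.
Qed.

(* The largest [w] with [tri w <= n]. *)
Definition tri_root n :=
  nat_rec (fun=> nat) 0 (fun i r => r + (1 - (tri r.+1 - i.+1))) n.

Lemma cfun_tri_root n G : cfun n G -> cfun n (fun v => tri_root (G v)).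
Proof.
apply: (cfun_app1 (f := tri_root)); apply/cfun1P.
apply: (cfun_rec (F := fun=> 0) (H := fun v =>
  nth 0 v 1 + (1 - (tri (nth 0 v 1).+1 - (nth 0 v 0).+1)))).
- exact: cfun_proj.
- exact: cfun_const.
- apply: cfun_add; first exact: cfun_proj.
  apply: cfun_sub; first exact: cfun_const.
  by apply: cfun_sub; [apply: cfun_tri|]; apply: cfun_succ; apply: cfun_proj.
Qed.

(** [tri (x + y)] is the start of the diagonal [x + y] and [y] the offset on it, so [tri_root] of a
    code recovers the diagonal. *)
Definition npair x y := tri (x + y) + y.
Definition nsnd n := n - tri (tri_root n).
Definition nfst n := tri_root n - nsnd n.

Lemma cfun_npair n G H :
  cfun n G -> cfun n H -> cfun n (fun v => npair (G v) (H v)).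
Proof. by move=> hG hH; apply: cfun_add => //; apply/cfun_tri/cfun_add. Qed.

Lemma cfun_nsnd n G : cfun n G -> cfun n (fun v => nsnd (G v)).
Proof. by move=> hG; apply: cfun_sub => //; apply/cfun_tri/cfun_tri_root. Qed.

Lemma triS n : tri n.+1 = tri n + n.+1. Proof. by []. Qed.

Lemma leq_tri m n : m <= n -> tri m <= tri n.
Proof. by elim: n => [|n IHn]; [case: m | rewrite leq_eqVlt triS => /predU1P[->//|/IHn]; lia]. Qed.

Lemma tri_rootS n :
  tri_root n.+1 = tri_root n + (1 - (tri (tri_root n).+1 - n.+1)).
Proof. by []. Qed.

(** From [n] to [n.+1] the root [w] rises by at most one, and [1 - (tri w.+1 - n.+1)] is 1 exactly
    when [tri w.+1 <= n.+1]. *)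
Lemma tri_rootP n : tri (tri_root n) <= n < tri (tri_root n).+1.
Proof.
elim: n => // n; rewrite tri_rootS; move: (tri_root n) => w IHn.
case: (leqP (tri w.+1) n.+1) => h.
  rewrite (_ : 1 - _ = 1) ?addn1; last by move: h; rewrite triS; lia.
  by move: h IHn; rewrite !triS; lia.
rewrite (_ : 1 - _ = 0) ?addn0; last by move: h; rewrite triS; lia.
by move: h IHn; rewrite !triS; lia.
Qed.

Lemma tri_root_unique n w : tri w <= n < tri w.+1 -> tri_root n = w.
Proof.
move=> hw; have hr := tri_rootP n; apply/eqP; rewrite eqn_leq.
by apply/andP; split; rewrite leqNgt; apply/negP=> /leq_tri; lia.
Qed.

Lemma tri_root_npair x y : tri_root (npair x y) = x + y.
Proof. by apply: tri_root_unique; rewrite triS /npair; lia. Qed.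

Lemma nsnd_npair x y : nsnd (npair x y) = y.
Proof. by rewrite /nsnd tri_root_npair /npair addKn. Qed.

Lemma nfst_npair x y : nfst (npair x y) = x.
Proof. by rewrite /nfst nsnd_npair tri_root_npair addnK. Qed.

Lemma npairK n : npair (nfst n) (nsnd n) = n.
Proof.
have := tri_rootP n; rewrite triS /npair => h.
rewrite /nfst subnK; first by rewrite /nsnd subnKC; lia.
by rewrite /nsnd; lia.
Qed.

(** * Computability on coded types *)

(** [decodeK] makes every number [n] the code of [decode n]; a map to [nat] can thus be read as a
    map to [A] with the same realizer on codes. *)
Class encodable (A : Type) := Encodable {
  enc : A -> nat;
  decode : nat -> A;
  decodeK : cancel decode enc }.

#[export] Instance encodable_nat : encodable nat :=
  @Encodable nat id id (fun=> erefl).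

#[export] Program Instance encodable_prod A B `{encodable A, encodable B} :
  encodable (A * B) :=
  @Encodable (A * B) (fun p => npair (enc p.1) (enc p.2))
    (fun n => (decode (nfst n), decode (nsnd n))) _.
Next Obligation. by move=> A B ? ? n; rewrite /= !decodeK npairK. Qed.

Definition computable A B `{encodable A, encodable B} (f : A -> B) : Prop :=
  exists2 h, computable_fun h & forall a, h (enc a) = enc (f a).

Lemma computable_funP (f : nat -> nat) : computable f <-> computable_fun f.
Proof.
split=> [[h [c hc] hf]|]; last by exists f.
by exists c => x; rewrite -[f x]hf.
Qed.

Section Combinators.
Context {A B C : Type} `{encodable A, encodable B, encodable C}.

Lemma computable_ext (f g : A -> B) : f =1 g -> computable f -> computable g.
Proof. by move=> efg [h hc hf]; exists h => // a; rewrite -efg. Qed.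

Lemma computable_id : computable (fun a : A => a).
Proof. by exists id => //; apply/cfun1P; apply: cfun_proj. Qed.

Lemma computable_const (b : B) : computable (fun _ : A => b).
Proof. by exists (fun=> enc b) => //; apply/cfun1P; apply: cfun_const. Qed.

Lemma computable_comp (g : B -> C) (f : A -> B) :
  computable g -> computable f -> computable (fun a => g (f a)).
Proof.
move=> [h hc hg] [k kc kf]; exists (fun n => h (k n)) => [|a].
  by apply/cfun1P; apply: cfun_app1 => //; apply/cfun1P.
by rewrite kf hg.
Qed.

Lemma computable_pair (f : A -> B) (g : A -> C) :
  computable f -> computable g -> computable (fun a => (f a, g a)).
Proof.
move=> [h /cfun1P hc hf] [k /cfun1P kc kg].
exists (fun n => npair (h n) (k n)) => [|a]; last by rewrite hf kg.
by apply/cfun1P; apply: cfun_npair.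
Qed.

Lemma computable_fst (f : A -> B * C) :
  computable f -> computable (fun a => (f a).1).
Proof.
move=> [h /cfun1P hc hf]; exists (fun n => nfst (h n)) => [|a].
  by apply/cfun1P; apply: cfun_sub; [exact: cfun_tri_root | exact: cfun_nsnd].
by rewrite hf nfst_npair.
Qed.

Lemma computable_snd (f : A -> B * C) :
  computable f -> computable (fun a => (f a).2).
Proof.
move=> [h /cfun1P hc hf]; exists (fun n => nsnd (h n)) => [|a].
  by apply/cfun1P; exact: cfun_nsnd.
by rewrite hf nsnd_npair.
Qed.

Lemma computable_decode (f : A -> nat) :
  computable f -> computable (fun a => decode (f a) : B).
Proof. by move=> [h hc hf]; exists h => // a; rewrite decodeK. Qed.

Lemma computable_succ (f : A -> nat) :
  computable f -> computable (fun a => (f a).+1).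
Proof.
move=> [h /cfun1P hc hf]; exists (fun n => (h n).+1) => [|a]; last by rewrite hf.
by apply/cfun1P; apply: cfun_succ.
Qed.

Lemma computable_rec (n : A -> nat) (f : A -> B) (g : A -> nat -> B -> B) :
    computable n -> computable f ->
    computable (fun p : A * nat * B => g p.1.1 p.1.2 p.2) ->
  computable (fun a => nat_rect (fun=> B) (f a) (g a) (n a)).
Proof.
move=> [h /cfun1P hc hn] [k /cfun1P kc kf] [l lc lg].
exists (fun x => nat_rec (fun=> nat) (k x) (fun i r => l (npair (npair x i) r)) (h x)).
  apply/cfun1P; apply: (cfun_rec (F := fun v => k (nth 0 v 0))
    (H := fun v => l (npair (npair (nth 0 v 2) (nth 0 v 0)) (nth 0 v 1))));
    [exact: hc | exact: kc |].
  by apply: (cfun_app1 (f := l)) => //; apply: cfun_npair; [apply: cfun_npair|]; apply: cfun_proj.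
move=> a; rewrite hn kf [enc (n a)]/=; elim: (n a) => //= i ->.
by have := lg (a, i, nat_rect (fun=> B) (f a) (g a) i).
Qed.

End Combinators.

Section Arithmetic.
Context {A : Type} `{encodable A}.
Implicit Types f g : A -> nat.

Lemma computable_app2 (op : nat -> nat -> nat) f g :
    cfun 2 (fun v => op (nth 0 v 0) (nth 0 v 1)) ->
  computable f -> computable g -> computable (fun a => op (f a) (g a)).
Proof.
move=> hop [h /cfun1P hc hf] [k /cfun1P kc kg].
exists (fun n => op (h n) (k n)) => [|a]; last by rewrite hf kg.
by apply/cfun1P; apply: cfun_app2.
Qed.

Lemma computable_add f g :
  computable f -> computable g -> computable (fun a => f a + g a).
Proof. by apply: computable_app2; apply: cfun_add; apply: cfun_proj. Qed.

Lemma computable_sub f g :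
  computable f -> computable g -> computable (fun a => f a - g a).
Proof. by apply: computable_app2; apply: cfun_sub; apply: cfun_proj. Qed.

End Arithmetic.

Definition cdec A `{encodable A} (P : A -> bool) : Prop :=
  computable (fun a => nat_of_bool (P a)).

Ltac computable_proj :=
  repeat first [ exact: computable_id | apply: computable_fst
               | apply: computable_snd ].

Section Arithmetic.
Context {A : Type} `{encodable A}.
Implicit Types f g : A -> nat.

Lemma computable_mul f g :
  computable f -> computable g -> computable (fun a => f a * g a).
Proof.
move=> hf hg; pose m a := nat_rect (fun=> nat) 0 (fun _ r => r + g a) (f a).
apply: (computable_ext (f := m)) => [a|].
  by rewrite /m; elim: (f a) => //= n ->; rewrite mulSn addnC.
apply: (computable_rec (f := fun=> 0)) => //; first exact: computable_const.
apply: computable_add; first by computable_proj.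
by apply: computable_comp => //; computable_proj.
Qed.

Lemma computable_exp2 f : computable f -> computable (fun a => 2 ^ f a).
Proof.
move=> hf; pose m a := nat_rect (fun=> nat) 1 (fun _ r => r + r) (f a).
apply: (computable_ext (f := m)) => [a|].
  by rewrite /m; elim: (f a) => //= n ->; rewrite expnS mul2n addnn.
apply: (computable_rec (f := fun=> 1)) => //; first exact: computable_const.
by apply: computable_add; computable_proj.
Qed.

Lemma cdec_comp B `{encodable B} (P : B -> bool) (f : A -> B) :
  cdec P -> computable f -> cdec (fun a => P (f a)).
Proof. by move=> hP hf; apply: (computable_comp hP hf). Qed.

Lemma cdec_ext (P Q : A -> bool) : P =1 Q -> cdec P -> cdec Q.
Proof. by move=> ePQ; apply: computable_ext => a; rewrite ePQ. Qed.

Lemma cdec_leq f g : computable f -> computable g -> cdec (fun a => f a <= g a).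
Proof.
move=> hf hg; apply: (computable_ext (f := fun a => 1 - (f a - g a))) => [a|].
  by rewrite -subn_eq0; case: (f a - g a).
by do 2?apply: computable_sub => //; apply: computable_const.
Qed.

Lemma cdec_and (P Q : A -> bool) : cdec P -> cdec Q -> cdec (fun a => P a && Q a).
Proof.
move=> hP hQ; apply: (computable_ext (f := fun a => P a * Q a)) => [a|].
  by rewrite mulnb.
exact: computable_mul.
Qed.

Lemma cdec_not (P : A -> bool) : cdec P -> cdec (fun a => ~~ P a).
Proof.
move=> hP; apply: (computable_ext (f := fun a => 1 - P a)) => [a|].
  by case: (P a).
by apply: computable_sub => //; apply: computable_const.
Qed.

Lemma cdec_or (P Q : A -> bool) : cdec P -> cdec Q -> cdec (fun a => P a || Q a).
Proof.
move=> hP hQ; apply: (cdec_ext (P := fun a => ~~ (~~ P a && ~~ Q a))) => [a|].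
  by rewrite negb_and !negbK.
by apply: cdec_not; apply: cdec_and; apply: cdec_not.
Qed.

Lemma cdec_imply (P Q : A -> bool) :
  cdec P -> cdec Q -> cdec (fun a => P a ==> Q a).
Proof.
move=> hP hQ; apply: (cdec_ext (P := fun a => ~~ P a || Q a)) => [a|].
  by rewrite implybE.
by apply: cdec_or => //; apply: cdec_not.
Qed.

Lemma cdec_eq f g : computable f -> computable g -> cdec (fun a => f a == g a).
Proof.
move=> hf hg.
apply: (cdec_ext (P := fun a => (f a <= g a) && (g a <= f a))) => [a|].
  by rewrite eqn_leq.
by apply: cdec_and; apply: cdec_leq.
Qed.

Lemma cdec_odd f : computable f -> cdec (fun a => odd (f a)).
Proof.
move=> hf; pose m a := nat_rect (fun=> nat) 0 (fun _ r => 1 - r) (f a).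
apply: (computable_ext (f := m)) => [a|].
  by rewrite /m; elim: (f a) => //= n ->; case: (odd n).
apply: (computable_rec (f := fun=> 0)) => //; first exact: computable_const.
by apply: computable_sub; [apply: computable_const | computable_proj].
Qed.

Lemma computable_count (P : A -> nat -> bool) f :
    cdec (fun p : A * nat => P p.1 p.2) -> computable f ->
  computable (fun a => count (P a) (iota 0 (f a))).
Proof.
move=> hP hf.
pose m a := nat_rect (fun=> nat) 0 (fun i r => r + P a i) (f a).
apply: (computable_ext (f := m)) => [a|].
  rewrite /m; elim: (f a) => // n IHn; rewrite [LHS]/= IHn.
  by rewrite -[in RHS]addn1 iotaD count_cat /= addn0.
apply: (computable_rec (f := fun=> 0)) => //; first exact: computable_const.
apply: computable_add; first by computable_proj.
by apply: (computable_comp hP); computable_proj.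
Qed.

Lemma cdec_all (P : A -> nat -> bool) f :
    cdec (fun p : A * nat => P p.1 p.2) -> computable f ->
  cdec (fun a => all (P a) (iota 0 (f a))).
Proof.
move=> hP hf.
apply: (cdec_ext (P := fun a => count (P a) (iota 0 (f a)) == f a)) => [a|].
  by rewrite all_count size_iota.
by apply: cdec_eq => //; apply: computable_count.
Qed.

End Arithmetic.

(** * Codes of finite sets and sequences *)

(* [bit a k]: the number [k] belongs to the finite set with canonical index [a]. *)
Definition bit (a k : nat) : bool := odd (iter k half a).

(* The [i]-th entry of the infinite sequence [w0, w1, ...] coded by
   [w = npair w0 (npair w1 ...)]. *)
Definition entry (w i : nat) : nat := nfst (iter i nsnd w).

Lemma entry0 x w : entry (npair x w) 0 = x.
Proof. exact: nfst_npair. Qed.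

Lemma entryS w i : entry w i.+1 = entry (nsnd w) i.
Proof. by rewrite /entry iterSr. Qed.

Lemma entry_cons x w i : entry (npair x w) i.+1 = entry w i.
Proof. by rewrite entryS nsnd_npair. Qed.

(** Codes carry no length: only an initial segment of the sequence is prescribed. This is how finite
    histories, vectors of witnesses and tables become single numbers. *)
Lemma entry_exists (s : nat -> nat) n : exists w, forall i, i < n -> entry w i = s i.
Proof.
elim: n s => [|n IHn] s; first by exists 0.
have [w hw] := IHn (fun i => s i.+1); exists (npair (s 0) w).
by case=> [|i] lt_in; rewrite ?entry0 // entry_cons hw.
Qed.

Section Coding.
Context {A : Type} `{encodable A}.
Implicit Types f g h : A -> nat.

Lemma computable_nfst f : computable f -> computable (fun a => nfst (f a)).
Proof.
move=> hf; apply: (computable_fst (f := fun a => decode (f a) : nat * nat)).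
exact: computable_decode.
Qed.

Lemma computable_nsnd f : computable f -> computable (fun a => nsnd (f a)).
Proof.
move=> hf; apply: (computable_snd (f := fun a => decode (f a) : nat * nat)).
exact: computable_decode.
Qed.

Lemma computable_npair f g :
  computable f -> computable g -> computable (fun a => npair (f a) (g a)).
Proof. by apply: computable_app2; apply: cfun_npair; apply: cfun_proj. Qed.

Lemma computable_half f : computable f -> computable (fun a => (f a)./2).
Proof.
move=> hf; pose m a := nat_rect (fun=> nat) 0 (fun i r => r + odd i) (f a).
apply: (computable_ext (f := m)) => [a|].
  rewrite /m; elim: (f a) => //= n ->.
  by rewrite uphalf_half addnC.
apply: (computable_rec (f := fun=> 0)) => //; first exact: computable_const.
by apply: computable_add; [|apply: cdec_odd]; computable_proj.
Qed.

End Coding.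

Section Coding.
Context {A : Type} `{encodable A}.
Implicit Types f g h : A -> nat.

Lemma computable_iter (u : nat -> nat) f g :
  computable u -> computable f -> computable g ->
  computable (fun a => iter (f a) u (g a)).
Proof.
move=> hu hf hg; pose m a := nat_rect (fun=> nat) (g a) (fun _ r => u r) (f a).
apply: (computable_ext (f := m)) => [a|].
  by rewrite /m; elim: (f a) => //= n ->.
apply: computable_rec => //.
by apply: (computable_comp hu); computable_proj.
Qed.

Lemma cdec_bit f g : computable f -> computable g -> cdec (fun a => bit (f a) (g a)).
Proof.
move=> hf hg; apply: cdec_odd; apply: computable_iter => //.
by apply: computable_half; apply: computable_id.
Qed.

Lemma computable_entry f g :
  computable f -> computable g -> computable (fun a => entry (f a) (g a)).
Proof.
move=> hf hg; apply: computable_nfst; apply: computable_iter => //.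
by apply: computable_nsnd; apply: computable_id.
Qed.

(** [CodeSeq.code] folds [2 ^ u * v.*2.+1] over the list, starting from 0; a list of three takes
    three such steps. *)
Lemma computable_code3 f g h :
  computable f -> computable g -> computable h ->
  computable (fun a => CodeSeq.code [:: f a; g a; h a]).
Proof.
move=> hf hg hh.
have hstep u v : computable u -> computable v ->
    computable (fun a : A => 2 ^ u a * (v a).*2.+1).
  move=> hu hv; apply: computable_mul; first exact: computable_exp2.
  apply: computable_succ.
  apply: (computable_ext (f := fun a => v a + v a)) => [a|]; first by rewrite addnn.
  exact: computable_add.
do 3![apply: (hstep) => //]; exact: computable_const.
Qed.

End Coding.

(** Follows the head symbol of the function through the closure lemmas; at other heads it tries a
    constant, a successor, or composition with a hypothesis. *)
Ltac computable_tac :=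
  lazymatch goal with
  | |- cdec (fun x => @eq_op _ _ _) => apply: cdec_eq; computable_tac
  | |- cdec (fun x => _ <= _) => apply: cdec_leq; computable_tac
  | |- cdec (fun x => _ && _) => apply: cdec_and; computable_tac
  | |- cdec (fun x => _ || _) => apply: cdec_or; computable_tac
  | |- cdec (fun x => _ ==> _) => apply: cdec_imply; computable_tac
  | |- cdec (fun x => ~~ _) => apply: cdec_not; computable_tac
  | |- cdec (fun x => bit _ _) => apply: cdec_bit; computable_tac
  | |- cdec (fun x => all _ (iota 0 _)) => apply: cdec_all; computable_tac
  | |- cdec ?T => first [ assumption
      | match goal with h : cdec ?U |- _ => apply: (cdec_comp h); computable_tac end ]
  | |- computable fst => exact: (computable_fst computable_id)
  | |- computable snd => exact: (computable_snd computable_id)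
  | |- computable (fun x => x) => exact: computable_id
  | |- computable (fun x => _ + _) => apply: computable_add; computable_tac
  | |- computable (fun x => _ * _) => apply: computable_mul; computable_tac
  | |- computable (fun x => _ - _) => apply: computable_sub; computable_tac
  | |- computable (fun x => entry _ _) => apply: computable_entry; computable_tac
  | |- computable (fun x => npair _ _) => apply: computable_npair; computable_tac
  | |- computable (fun x => nfst _) => apply: computable_nfst; computable_tac
  | |- computable (fun x => nsnd _) => apply: computable_nsnd; computable_tac
  | |- computable (fun x => CodeSeq.code _) => apply: computable_code3; computable_tac
  | |- computable (fun x => count _ (iota 0 _)) => apply: computable_count; computable_tac
  | |- computable (fun x => (_, _)) => apply: computable_pair; computable_tac
  | |- computable (fun x => fst _) => apply: computable_fst; computable_tac
  | |- computable (fun x => snd _) => apply: computable_snd; computable_tac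
  | |- computable (fun x => decode _) => apply: computable_decode; computable_tac
  | |- computable ?f => first [ exact: computable_const | assumption
      | apply: computable_succ; computable_tac
      | match goal with h : computable ?g |- _ => apply: (computable_comp h); computable_tac end ]
  end.

(** * Sigma^0_1 and Pi^0_2 predicates *)

Definition Sigma01 A `{encodable A} (P : A -> Prop) : Prop :=
  exists2 T : A * nat -> bool, cdec T & forall a, P a <-> exists w, T (a, w).

Section Sigma.
Context {A : Type} {encA : encodable A}.

Lemma Sigma01_ext (P Q : A -> Prop) :
  (forall a, P a <-> Q a) -> Sigma01 P -> Sigma01 Q.
Proof. by move=> ePQ [T cT hT]; exists T => // a; rewrite -ePQ. Qed.

Lemma Sigma01_dec (P : A -> bool) : cdec P -> Sigma01 (fun a => P a).
Proof.
move=> hP; exists (fun p => P p.1); first by computable_tac.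
by move=> a; split=> [|[]//]; exists 0.
Qed.

Lemma Sigma01_and (P Q : A -> Prop) :
  Sigma01 P -> Sigma01 Q -> Sigma01 (fun a => P a /\ Q a).
Proof.
move=> [T cT hT] [U cU hU].
exists (fun p => T (p.1, nfst p.2) && U (p.1, nsnd p.2)); first by computable_tac.
move=> a; rewrite hT hU; split=> [[[w hw] [x hx]]|[w /andP[hw hx]]].
  by exists (npair w x); rewrite nfst_npair nsnd_npair hw.
by split; [exists (nfst w) | exists (nsnd w)].
Qed.

Lemma Sigma01_imp (b : A -> bool) (P : A -> Prop) :
  cdec b -> Sigma01 P -> Sigma01 (fun a => b a -> P a).
Proof.
move=> cb [T cT hT].
exists (fun p => b p.1 ==> T p); first by computable_tac.
move=> a; rewrite hT /=; case: (b a) => /=; split=> //.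
- by move/(_ isT).
- by exists 0.
Qed.

Lemma Sigma01_subst B `{encodable B} (P : B -> Prop) (f : A -> B) :
  Sigma01 P -> computable f -> Sigma01 (fun a => P (f a)).
Proof.
move=> [T cT hT] cf; exists (fun p => T (f p.1, p.2)) => [|a]; last exact: hT.
by apply: (computable_comp cT); computable_tac.
Qed.

Lemma Sigma01_ex (P : A -> nat -> Prop) :
  Sigma01 (fun p : A * nat => P p.1 p.2) -> Sigma01 (fun a => exists x, P a x).
Proof.
move=> [T cT hT]; exists (fun p => T (p.1, nfst p.2, nsnd p.2)); first by computable_tac.
move=> a; split=> [[x /(hT (a, x))[w hw]]|[w hw]].
  by exists (npair x w); rewrite nfst_npair nsnd_npair.
by exists (nfst w); apply/(hT (a, nfst w)); exists (nsnd w).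
Qed.

(** Collection: the witnesses for all [i < n a] are gathered into one sequence code, after which the
    bounded quantifier is decidable. *)
Lemma Sigma01_ball (P : A -> nat -> Prop) (n : A -> nat) :
    Sigma01 (fun p : A * nat => P p.1 p.2) -> computable n ->
  Sigma01 (fun a => forall i, i < n a -> P a i).
Proof.
move=> [T cT hT] cn.
exists (fun p => all (fun i => T (p.1, i, entry p.2 i)) (iota 0 (n p.1))).
  by computable_tac.
move=> a; split=> [hP|[w /allP hw] i lt_in]; last first.
  by apply/(hT (a, i)); exists (entry w i); apply: hw; rewrite mem_iota.
have /choice[s hs] : forall i, exists w, i < n a -> T (a, i, w).
  move=> i; case: (boolP (i < n a)) => [/hP/(hT (a, i))[w]|_]; last by exists 0.
  by exists w.
have [w hw] := entry_exists s (n a); exists w; apply/allP=> i.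
by rewrite mem_iota => /= lt_in; rewrite hw // hs.
Qed.

(** Here each index has its own predicate with its own decision procedure, with no uniformity in
    [i], so the conjunction is built by induction along the finite list of indices. *)
Lemma Sigma01_fin m (P : 'I_m -> A -> Prop) :
  (forall i, Sigma01 (P i)) -> Sigma01 (fun a => forall i, P i a).
Proof.
move=> hP; suff hs (s : seq 'I_m) :
    Sigma01 (H := encA) (fun a => forall i, i \in s -> P i a).
  move: (hs (enum 'I_m)); apply: Sigma01_ext => a; split=> h i; last by move=> _.
  by apply: h; rewrite mem_enum.
elim: s => [|j s IHs].
  apply: (Sigma01_ext (P := fun=> true)) => [a|]; first by split.
  by apply: Sigma01_dec; apply: computable_const.
move: (Sigma01_and (hP j) IHs); apply: Sigma01_ext => a; split=> [[hj hs] i|h].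
  by rewrite inE => /predU1P[->|/hs].
by split=> [|i hi]; apply: h; rewrite inE ?eqxx ?hi ?orbT.
Qed.

End Sigma.

Ltac sigma_with tac :=
  lazymatch goal with
  | |- Sigma01 (fun a => _ /\ _) => apply: Sigma01_and; sigma_with tac
  | |- Sigma01 (fun a => exists x : nat, _) => apply: Sigma01_ex; sigma_with tac
  | |- Sigma01 (fun a => forall i : nat, is_true (i < _) -> _) =>
      apply: Sigma01_ball; [sigma_with tac | computable_tac]
  | |- Sigma01 (fun a => is_true _ -> _) =>
      apply: Sigma01_imp; [computable_tac | sigma_with tac]
  | |- Sigma01 (fun a => is_true _) => apply: Sigma01_dec; computable_tac
  | |- Sigma01 _ => tac
  end.

Ltac sigma_tac := sigma_with ltac:(idtac;
  match goal with h : Sigma01 _ |- _ =>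
    apply: (Sigma01_subst h); computable_tac
  end).

(** * The graph of a partial computable function *)

(** Argument vectors are read off numbers, so that predicates on vectors of every length become
    predicates on [nat]. *)
Definition entries n (w : nat) : n.-tuple nat := [tuple entry w i | i < n].

Lemma entries_cons n x w : cons_tuple x (entries n w) = entries n.+1 (npair x w).
Proof.
apply: eq_from_tnth => i; rewrite tnth_mktuple.
case: (unliftP ord0 i) => [j|] ->; last by rewrite entry0.
by rewrite tnthS tnth_mktuple lift0 entry_cons.
Qed.

Lemma entries_thead n w : thead (entries n.+1 w) = entry w 0.
Proof. by rewrite /thead tnth_mktuple. Qed.

Lemma entries_behead n w : behead_tuple (entries n.+1 w) = entries n (nsnd w).
Proof.
apply: eq_from_tnth => i; rewrite tnth_behead !tnth_mktuple -entryS.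
by rewrite inordK // ltnS ltn_ord.
Qed.

Lemma entries_exists n (v : n.-tuple nat) : exists w, v = entries n w.
Proof.
have [w hw] := entry_exists (fun i => nth 0 v i) n; exists w.
by apply: eq_from_tnth => i; rewrite tnth_mktuple hw // (tnth_nth 0).
Qed.

(** Each evaluation clause is rewritten with numbers in place of vectors and histories; only
    existential and bounded universal quantifiers then occur. *)
Lemma Sigma01_ev n (f : recf n) :
  Sigma01 (fun p : nat * nat => ev f (entries n p.1) p.2).
Proof.
elim: f => {n} [n||n i|m n f IHf h IHh|n f IHf h IHh|n f IHf].
- apply: (Sigma01_ext (P := fun p => p.2 == 0)) => [p|]; last by sigma_tac.
  by split=> /eqP.
- apply: (Sigma01_ext (P := fun p => p.2 == (entry p.1 0).+1)) => [p|]; last by sigma_tac.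
  by rewrite /= entries_thead; split=> /eqP.
- apply: (Sigma01_ext (P := fun p => p.2 == entry p.1 i)) => [p|]; last by sigma_tac.
  by rewrite /= tnth_mktuple; split=> /eqP.
(* [w] codes the vector of intermediate values. *)
- apply: (Sigma01_ext (P := fun p => exists w,
    (forall i, ev (h i) (entries n p.1) (entry w i)) /\ ev f (entries m w) p.2)) => [p|].
    split=> [[w [hw fw]]|[w [hw fw]]].
      by exists (entries m w); split=> // i; rewrite tnth_mktuple; apply: hw.
    have [w' ew] := entries_exists w; exists w'; rewrite -ew; split=> // i.
    by have := hw i; rewrite ew tnth_mktuple.
  apply: Sigma01_ex; apply: Sigma01_and.
    by apply: Sigma01_fin => i; apply: (Sigma01_subst (f := fun p : nat * nat * nat =>
      (p.1.1, entry p.2 i)) (IHh i)); computable_tac.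
  by apply: (Sigma01_subst (f := fun p : nat * nat * nat => (p.2, p.1.2)) IHf);
     computable_tac.
(* [w] codes the history of the recursion; [entry p.1 0] is the recursion argument and [nsnd p.1]
   codes the parameters. *)
- apply: (Sigma01_ext (P := fun p => exists w,
    ev f (entries n (nsnd p.1)) (entry w 0) /\
    (forall i, i < entry p.1 0 ->
      ev h (entries n.+2 (npair i (npair (entry w i) (nsnd p.1)))) (entry w i.+1)) /\
    p.2 == entry w (entry p.1 0))) => [p|].
    rewrite /= entries_thead entries_behead.
    split=> [[w [fw [hw /eqP yw]]]|[s [fs hs ys]]].
      exists (entry w); split=> // i /hw; by rewrite !entries_cons.
    (* One entry more than the number of steps, as the history starts with the base value. *)
    have [w hw] := entry_exists s (entry p.1 0).+1; exists w; rewrite !hw // -ys eqxx.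
    split=> //; split=> // i lt_i; rewrite -!entries_cons (hw i.+1) // (hw i).
      exact: hs.
    by rewrite ltnW.
  apply: Sigma01_ex; apply: Sigma01_and; last apply: Sigma01_and; last by sigma_tac.
    by apply: (Sigma01_subst (f := fun p : nat * nat * nat =>
      (nsnd p.1.1, entry p.2 0)) IHf); computable_tac.
  apply: Sigma01_ball; last by computable_tac.
  by apply: (Sigma01_subst (f := fun p : nat * nat * nat * nat =>
    (npair p.2 (npair (entry p.1.2 p.2) (nsnd p.1.1.1)), entry p.1.2 p.2.+1)) IHh);
    computable_tac.
- apply: (Sigma01_ext (P := fun p => ev f (entries n.+1 (npair p.2 p.1)) 0 /\
    forall i, i < p.2 -> exists k, ev f (entries n.+1 (npair i p.1)) k.+1)) => [p|].
    rewrite -entries_cons; split=> -[fy fi]; split=> // i /fi[k hk]; exists k.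
      by rewrite entries_cons.
    by rewrite -entries_cons.
  apply: Sigma01_and.
    by apply: (Sigma01_subst (f := fun p : nat * nat => (npair p.2 p.1, 0)) IHf);
       computable_tac.
  apply: Sigma01_ball; last by computable_tac.
  apply: Sigma01_ex.
  by apply: (Sigma01_subst (f := fun p : nat * nat * nat * nat =>
    (npair p.1.2 p.1.1.1, p.2.+1)) IHf); computable_tac.
Qed.

Lemma Sigma01_ev2 A `{encodable A} (phi : recf 2) (k x y : A -> nat) :
    computable k -> computable x -> computable y ->
  Sigma01 (fun a => ev phi [tuple k a; x a] (y a)).
Proof.
move=> ck cx cy.
have h : computable (fun a => (npair (k a) (npair (x a) 0), y a)) by computable_tac.
move: (Sigma01_subst (Sigma01_ev phi) h); apply: Sigma01_ext => a /=.
rewrite -!entries_cons (_ : cons_tuple _ _ = [tuple k a; x a]) //.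
by rewrite (tuple0 (entries 0 0)); apply: val_inj.
Qed.

(** Determinism of evaluation; it identifies a value that is merely asserted to exist with the value
    of the chosen total function. *)
Lemma ev_functional n (f : recf n) v y z : ev f v y -> ev f v z -> y = z.
Proof.
elim: f v y z => {n} [n||n i|m n f IHf h IHh|n f IHf h IHh|n f IHf] v y z /=.
- by move=> -> ->.
- by move=> -> ->.
- by move=> -> ->.
- move=> [w [hw fw]] [w' [hw' fw']]; apply: IHf fw _.
  rewrite (_ : w = w') //; apply: eq_from_tnth => i; exact: IHh (hw i) (hw' i).
- move=> [s [fs hs ->]] [s' [fs' hs' ->]].
  (* The two histories agree at every stage up to [thead v], by induction on the stage. *)
  have: thead v <= thead v by []; elim: {1 3 4}(thead v) => [|i IHi] lt_i.
    exact: IHf fs fs'.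
  by apply: IHh (hs i lt_i) _; rewrite IHi 1?ltnW //; exact: hs'.
- move=> [fy ly] [fz lz]; case: (ltngtP y z) => // lt_yz.
    by have [k /(IHf _ _ _ fy)] := lz _ lt_yz.
  by have [k /(IHf _ _ _ fz)] := ly _ lt_yz.
Qed.

(** * Closure properties of Pi^0_2 predicates *)

(** With an abstract Sigma^0_1 matrix, conjunctions and decidable premises are handled inside the
    matrix, and consecutive universal quantifiers merge by pairing. *)
Definition cPi02 A `{encodable A} (P : A -> Prop) : Prop :=
  exists2 S : A * nat -> Prop, Sigma01 S & forall a, P a <-> forall y, S (a, y).

Section Pi.
Context {A : Type} {encA : encodable A}.

Lemma cPi02_ext (P Q : A -> Prop) : (forall a, P a <-> Q a) -> cPi02 P -> cPi02 Q.
Proof. by move=> ePQ [S sS hS]; exists S => // a; rewrite -ePQ. Qed.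

Lemma cPi02_Sigma01 (P : A -> Prop) : Sigma01 P -> cPi02 P.
Proof.
move=> sP; exists (fun p => P p.1); last by move=> a; split=> // /(_ 0).
by apply: (Sigma01_subst sP); computable_tac.
Qed.

Lemma cPi02_and (P Q : A -> Prop) : cPi02 P -> cPi02 Q -> cPi02 (fun a => P a /\ Q a).
Proof.
move=> [S sS hS] [T sT hT]; exists (fun p => S p /\ T p).
  exact: Sigma01_and.
move=> a; rewrite hS hT; split=> [[hs ht] y|h]; first by split.
by split=> y; have [] := h y.
Qed.

Lemma cPi02_imp (b : A -> bool) (P : A -> Prop) :
  cdec b -> cPi02 P -> cPi02 (fun a => b a -> P a).
Proof.
move=> cb [S sS hS]; exists (fun p => b p.1 -> S p); first by sigma_tac.
by move=> a; rewrite hS; split=> h; [move=> y ab|move=> ab y]; exact: h.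
Qed.

Lemma cPi02_all (P : A -> nat -> Prop) :
  cPi02 (fun p : A * nat => P p.1 p.2) -> cPi02 (fun a => forall x, P a x).
Proof.
move=> [S sS hS]; exists (fun p => S (p.1, nfst p.2, nsnd p.2)); first by sigma_tac.
move=> a; split=> [h y|h x]; first exact: (hS (a, nfst y)).1.
by apply/(hS (a, x)) => y; have := h (npair x y); rewrite nfst_npair nsnd_npair.
Qed.

End Pi.

Lemma cPi02_Pi02 (P : nat -> Prop) : cPi02 P -> Pi02 P.
Proof.
move=> [S [T [h [c hc] hT] sS] hS].
exists (fun x y z => T (x, y, z)).
  have [||d hd] := @cfun_app1 3 h (fun v => npair (npair (nth 0 v 0) (nth 0 v 1)) (nth 0 v 2)).
  - by exists c.
  - by apply: cfun_npair; [apply: cfun_npair|]; apply: cfun_proj.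
  by exists d => x y z; rewrite -[nat_of_bool _]hT; exact: hd.
by move=> x; rewrite hS; split=> h' y; apply/sS.
Qed.

Ltac pi_tac :=
  lazymatch goal with
  | |- cPi02 (fun a => _ /\ _) => apply: cPi02_and; pi_tac
  | |- cPi02 (fun a => forall x : nat, _) => apply: cPi02_all; pi_tac
  | |- cPi02 (fun a => is_true _ -> _) =>
      apply: cPi02_imp; [computable_tac | pi_tac]
  | |- cPi02 _ => apply: cPi02_Sigma01;
      sigma_with ltac:(apply: Sigma01_ev2; computable_tac)
  end.

(** * Canonical indices of finite sets and operations *)

Lemma bit0n k : bit 0 k = false.
Proof. by elim: k => // k; rewrite /bit iterSr. Qed.

Lemma bitS a k : bit a k.+1 = bit a./2 k.
Proof. by rewrite /bit iterSr. Qed.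

Lemma bit_inj a b : bit a =1 bit b -> a = b.
Proof.
elim/ltn_ind: a b => a IHa b hab.
have h0 : odd a = odd b := hab 0.
case: (posnP a) => [a0|a_gt0].
  case: (posnP b) => [->//|b_gt0]; exfalso.
  (* A positive number has a set bit, found by halving until it is odd. *)
  suff [k hk] : exists k, bit b k by move: hk; rewrite -hab a0 bit0n.
  elim/ltn_ind: b b_gt0 {hab h0} => b IHb b_gt0.
  case: (boolP (odd b)) => ob; first by exists 0.
  have [||k hk] := IHb b./2; [lia | lia | by exists k.+1; rewrite bitS].
rewrite -(odd_double_half a) -(odd_double_half b) h0; congr (_ + _.*2).
by apply: IHa => [|k]; [lia | rewrite -!bitS].
Qed.

(** The bit [x] of [m] is clear, so the addition produces no carry. *)
Lemma bit_exp2_add x m j : ~~ bit m x -> bit (2 ^ x + m) j = (j == x) || bit m j.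
Proof.
elim: x m j => [|x IHx] m [|j].
- by rewrite /bit /= => /negbTE ->.
- by rewrite !bitS /bit /= => om; rewrite uphalf_half (negbTE om).
- by rewrite /bit /= oddD oddX.
- rewrite !bitS => mx; rewrite eqSS -IHx //.
  by congr (bit _ _); rewrite expnS; lia.
Qed.

Lemma bit_sum_exp2 (s : seq nat) k : uniq s -> bit (\sum_(j <- s) 2 ^ j) k = (k \in s).
Proof.
elim: s k => [|x s IHs] k; first by rewrite big_nil bit0n.
rewrite big_cons inE /= => /andP[xs us].
by rewrite bit_exp2_add IHs.
Qed.

(** Makes quantifiers over a finite set bounded by its canonical index. *)
Lemma bit_lt a k : bit a k -> k < a.
Proof.
elim: k a => [|k IHk] a; first by case: a.
by rewrite bitS => /IHk; lia.
Qed.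

Lemma bit_godel_fset (D : {fset nat}) k : bit (godel_fset D) k = (k \in D).
Proof. by rewrite /godel_fset bit_sum_exp2 // fset_uniq. Qed.

Lemma godel_fset_surj a : exists D, godel_fset D = a.
Proof.
exists [fset k in [seq k <- iota 0 a | bit a k]]%fset; apply: bit_inj => k.
rewrite bit_godel_fset !inE mem_filter mem_iota /=.
by case: (boolP (bit a k)) => // /bit_lt.
Qed.

Lemma code_inj : injective CodeSeq.code.
Proof. exact: can_inj CodeSeq.codeK. Qed.

Lemma bit_godel_op (op : {fmap nat * nat -> nat}) q :
  bit (godel_op op) q <->
  exists x y z, q = CodeSeq.code [:: x; y; z] /\ op.[? (x, y)]%fmap = Some z.
Proof.
rewrite /godel_op -(big_map (fun p : domf op =>
  CodeSeq.code [:: (val p).1; (val p).2; op p]) predT (fun j => 2 ^ j)).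
rewrite bit_sum_exp2; last first.
  rewrite map_inj_uniq ?index_enum_uniq // => p p' /code_inj[e1 e2 _].
  by apply/val_inj; rewrite [LHS]surjective_pairing e1 e2 -surjective_pairing.
split=> [/mapP[p _ ->]|[x [y [z [-> opz]]]]].
  exists (val p).1, (val p).2, (op p); split=> //.
  by rewrite -surjective_pairing Some_fnd.
have /fndSomeP[xy_op <-] := opz.
by apply/mapP; exists [` xy_op]%fset => //; rewrite mem_index_enum.
Qed.

Lemma bit_godel_op_code op x y z :
  bit (godel_op op) (CodeSeq.code [:: x; y; z]) = (op.[? (x, y)]%fmap == Some z).
Proof.
apply/idP/eqP => [/bit_godel_op[x' [y' [z' [/code_inj[-> -> ->]]]]]//|h].
by apply/bit_godel_op; exists x, y, z.
Qed.

(** The two hypotheses say that [b] is the index of a finite set of triples which is the graph of a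
    partial function; the operation is read off that graph. *)
Lemma godel_op_surj b :
    (forall q, bit b q -> exists x y z, q = CodeSeq.code [:: x; y; z]) ->
    (forall x y z z', bit b (CodeSeq.code [:: x; y; z]) ->
       bit b (CodeSeq.code [:: x; y; z']) -> z = z') ->
  exists op, godel_op op = b.
Proof.
move=> b3 bfun.
pose r (p : nat * nat) z := bit b (CodeSeq.code [:: p.1; p.2; z]).
have r_lt p z : r p z -> [/\ p.1 < b, p.2 < b & z < b].
  move=> /bit_lt lt_b; have /and4P[lt1 lt2 lt3 _] := CodeSeq.ltn_code [:: p.1; p.2; z].
  by split; apply: ltn_trans lt_b.
(* The domain is finite because a coded triple exceeds its entries, so all entries are below [b]. *)
pose S := [fset p in [seq p <- allpairs pair (iota 0 b) (iota 0 b) |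
  has (r p) (iota 0 b)]]%fset.
have inS p z : r p z -> p \in S.
  move=> rpz; have [lt1 lt2 lt3] := r_lt _ _ rpz.
  rewrite !inE mem_filter; apply/andP; split.
    by apply/hasP; exists z; rewrite ?mem_iota.
  by case: p lt1 lt2 {rpz} => x y lt1 lt2; apply: allpairs_f; rewrite mem_iota.
have /choice[F hF] : forall p, exists z, p \in S -> r p z.
  move=> p; case: (boolP (p \in S)) => [|_]; last by exists 0.
  by rewrite !inE mem_filter => /andP[/hasP[z _ rz] _]; exists z.
exists [fmap p : S => F (val p)]%fmap; apply: bit_inj => q; apply/idP/idP.
  move=> /bit_godel_op[x [y [z [->]]]]; case: fndP => // xyS [<-].
  by rewrite ffunE; exact: hF.
move=> bq; have [x [y [z eq]]] := b3 _ bq; rewrite eq bit_godel_op_code.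
have rz : r (x, y) z by rewrite /r -eq.
have xyS := inS _ _ rz.
rewrite in_fnd ffunE; apply/eqP; congr Some.
by apply: bfun (hF _ xyS) rz.
Qed.

(** * Hamming distances and profiles in terms of natural numbers *)

Lemma card_ord_count N (P : pred nat) : #|[pred i : 'I_N | P i]| = count P (iota 0 N).
Proof.
rewrite -val_enum_ord count_map -sum1_card -sum1_count big_enum_cond.
by apply: eq_bigl => i; rewrite inE.
Qed.

Import Order.TTheory GRing.Theory Num.Theory.

Section Hamming.
Variables (R : realType) (N : nat).
Hypothesis N_gt0 : 0 < N.
Implicit Types s t : 'S_N.

Lemma dH_agree s t : dH R s t = (1 - #|[pred i | s i == t i]|%:R / N%:R)%R.
Proof.
rewrite /dH; congr (1 - _%:R / _)%R; apply: eq_card => i.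
by rewrite !inE /pmulS permM (canF_eq (permK s)) eq_sym.
Qed.

Lemma dH_disagree s t : dH R s t = (#|[pred i | s i != t i]|%:R / N%:R)%R.
Proof.
have N0 : (N%:R != 0 :> R)%R by rewrite pnatr_eq0 -lt0n.
have := cardC [pred i | s i == t i]; rewrite card_ord dH_agree => eN.
rewrite -[X in (X - _)%R](divff N0) -mulrBl -{1}eN natrD addrC addKr.
by congr (_%:R / _)%R; apply: eq_card.
Qed.

(** For a natural threshold, clearing denominators leaves an inequality between natural numbers,
    which is decidable on tables; likewise in [dH_leE]. *)
Lemma dH_geE r s t : 0 < r ->
  (1 - r%:R^-1 <= dH R s t)%R = (#|[pred i | s i == t i]| * r <= N).
Proof.
move=> r_gt0; rewrite dH_agree lerD2l lerN2 ler_pdivrMr ?ltr0n //.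
by rewrite mulrC ler_pdivlMr ?ltr0n // -natrM ler_nat.
Qed.

Lemma dH_leE r s t : 0 < r ->
  (dH R s t <= r%:R^-1)%R = (#|[pred i | s i != t i]| * r <= N).
Proof.
move=> r_gt0; rewrite dH_disagree ler_pdivrMr ?ltr0n //.
by rewrite mulrC ler_pdivlMr ?ltr0n // -natrM ler_nat.
Qed.

End Hamming.

(** An infimum is below [+oo] iff some [N] qualifies, and natural thresholds are cofinal among the
    reals. Growth gives [m < g m <= N], which makes the truncated [N - m] exact. *)
Lemma prof_finiteP (R : realType) (g : nat -> nat) : growth_fun g ->
  (forall r : R, (1 <= r)%R -> (prof g r < +oo)%E) <->
  (forall r : nat, exists N m, g m <= N /\ (N - m) * r.+1 < N).
Proof.
move=> hg.
have key N m r : g m <= N ->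
    ((N%:R - m%:R) / N%:R < r.+1%:R^-1 :> R)%R = ((N - m) * r.+1 < N).
  move=> gN; have mN : m < N by apply: leq_trans gN; have [] := hg m.
  have N_gt0 : 0 < N by apply: leq_ltn_trans mN.
  rewrite ltr_pdivrMr ?ltr0n //.
  by rewrite mulrC ltr_pdivlMr ?ltr0n // -natrB ?(ltnW mN) // -natrM ltr_nat.
split=> [hp r|hp r r_ge1].
  have /ereal_inf_lt[_ [N [m [gN hN]] _] _] := hp r.+1%:R%R (ler1n R r.+1).
  by exists N, m; rewrite -key.
have r_ge0 : (0 <= r)%R by apply: le_trans r_ge1.
have [N [m [gN]]] := hp (Num.bound r); rewrite -key // => hN.
apply: le_lt_trans (ltry (N%:R : R)%R); apply: ereal_inf_lbound.
exists N => //; exists m; split=> //; apply: lt_le_trans hN _.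
rewrite lef_pV2 ?posrE ?ltr0n //; last exact: lt_le_trans r_ge1.
by apply: le_trans (ltW (archi_boundP r_ge0)) _; rewrite ler_nat.
Qed.

Lemma perm_of_nat_fun N (u : nat -> nat) :
    (forall i, i < N -> u i < N) ->
    (forall i j, i < N -> j < N -> i != j -> u i != u j) ->
  exists s : 'S_N, forall i, s i = u i :> nat.
Proof.
move=> u_lt u_inj; pose v (i : 'I_N) := Ordinal (u_lt i (ltn_ord i)).
have v_inj : injective v.
  move=> i j /(congr1 val) /= uij; apply/val_inj/eqP/negPn/negP => ij.
  by have := u_inj _ _ (ltn_ord i) (ltn_ord j) ij; rewrite uij eqxx.
by exists (perm v_inj) => i; rewrite permE.
Qed.

(** * Arithmetical form of the three conditions *)

(** These are exactly the [b] of the form [godel_op op] with [op] a partial operation on the set of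
    index [a]. *)
Definition arith_op (a b : nat) : Prop :=
  (forall q, bit b q -> exists x y z,
     q == CodeSeq.code [:: x; y; z] /\ [&& bit a x, bit a y & bit a z]) /\
  (forall x y z z', bit b (CodeSeq.code [:: x; y; z]) ->
     bit b (CodeSeq.code [:: x; y; z']) -> z == z').

(** A boolean with a bounded quantifier, so that it can serve as a decidable premise. *)
Definition arith_unit (a b e : nat) : bool :=
  bit a e && all (fun x => bit a x ==>
    (bit b (CodeSeq.code [:: e; x; x]) && bit b (CodeSeq.code [:: x; e; x])))
    (iota 0 a).

Section Arith.
Variable phi : recf 2.
Local Notation G k x y := (ev phi [tuple k; x] y).

(** Reading values existentially asserts definedness at the same time and keeps the matrix
    Sigma^0_1. *)
Definition arith_profile (n : nat) : Prop :=
  (forall x, exists y y', G n x y /\ G n x.+1 y' /\ (y <= y') && (x < y)) /\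
  (forall r, exists N m y, G n m y /\ (y <= N) && ((N - m) * r.+1 < N)).

(** The bound is required only at equal arguments; for [m <= x] it follows from monotonicity of the
    bounding function. The next clauses give injectivity, surjectivity and the identity. *)
Definition arith_chunk (a n e : nat) : Prop :=
  (forall k x, bit a k -> exists y z, G k x y /\ G n x z /\ y <= z) /\
  (forall k (x x' : nat), bit a k -> x != x' ->
     exists y y', G k x y /\ G k x' y' /\ y != y') /\
  (forall k y, bit a k -> exists x, G k x y) /\
  (forall x, G e x x).

(** The homomorphism condition appears in contrapositive form: a difference of two functions is
    witnessed at one point, whereas their equality could not be a decidable premise. *)
Definition arith_realizes (a b : nat) : Prop :=
  (forall k l : nat, bit a k -> bit a l -> k != l ->
     exists x y y', G k x y /\ G l x y' /\ y != y') /\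
  (forall k l m, bit a k -> bit a l -> bit a m ->
     ~~ bit b (CodeSeq.code [:: k; l; m]) ->
     exists x y z w, G l x y /\ G k y z /\ G m x w /\ z != w).

(* [i |-> entry w (npair k i)] is the permutation of [{0, ..., N-1}] assigned
   to [phi_k]; the point [i] stands for [i.+1]. *)
Definition arith_sofic (a b e : nat) : Prop :=
  forall r, exists N w, 0 < N /\
  (forall k, k < a -> bit a k ->
    (forall i, i < N -> entry w (npair k i) < N) /\
    (forall i, i < N -> forall j, j < N -> i != j ->
       entry w (npair k i) != entry w (npair k j)) /\
    (forall i, i < N -> exists y, G k i.+1 y /\
       ((0 < y <= N) ==> ((entry w (npair k i)).+1 == y)))) /\
  (forall i, i < N -> entry w (npair e i) == i) /\
  (forall k, k < a -> forall l, l < a -> bit a k -> bit a l -> k != l ->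
    count (fun i => entry w (npair k i) == entry w (npair l i)) (iota 0 N)
      * r.+2 <= N) /\
  (forall k, k < a -> forall l, l < a -> forall m, m < a ->
    bit b (CodeSeq.code [:: k; l; m]) ->
    count (fun i => entry w (npair m i) !=
      entry w (npair k (entry w (npair l i)))) (iota 0 N) * r.+2 <= N).

Definition arith_triple (a b n e : nat) : Prop :=
  arith_op a b /\ arith_profile n /\ arith_chunk a n e /\
  arith_realizes a b /\ arith_sofic a b e.

(** An existential quantifier in front of a Pi^0_2 condition must be avoided. The code determines
    [a], [b], [n], and these determine the unit [e], so existence is asserted for the decidable part
    only and the rest is required of all such data. *)
Lemma cPi02_arith (c : nat -> Prop) :
    (forall x, c x <->
       (exists a b n e, x == CodeSeq.code [:: a; b; n] /\ arith_unit a b e) /\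
       (forall a b n e, x == CodeSeq.code [:: a; b; n] -> arith_unit a b e ->
          arith_triple a b n e)) ->
  cPi02 c.
Proof.
move=> hc; apply: cPi02_ext (fun x => iff_sym (hc x)) _.
rewrite /arith_triple /arith_op /arith_profile /arith_chunk /arith_realizes.
rewrite /arith_sofic /arith_unit.
by pi_tac.
Qed.
End Arith.

Lemma leq_npair x y x' y' : x <= x' -> y <= y' -> npair x y <= npair x' y'.
Proof. by move=> hx hy; rewrite leq_add // leq_tri // leq_add. Qed.

(** * Equivalence of the arithmetical form with the definition *)

Section Equivalence.
Variables (R : realType) (phi : recf 2) (D : {fset nat}).
Variables (op : {fmap nat * nat -> nat}) (n e : nat).
Local Notation a := (godel_fset D).
Local Notation b := (godel_op op).
Implicit Types (p : nat -> nat -> nat) (g : nat -> nat).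

Definition supp_sofic_approx p (c : R) : Prop :=
  exists (N : nat) (sigma : (nat -> nat) -> 'S_N),
    let h : op_pstruct D op e -> 'S_N := fun k => sigma (p k) in
    [/\ 0 < N, supp_morphism [set p k | k in [set k | k \in D]]%classic sigma,
        expansive (1 - c)%R h & eps_morphism c h].

Lemma arith_unitP : reflect (op_unit D op e) (arith_unit a b e).
Proof.
rewrite /arith_unit bit_godel_fset; apply: (iffP andP) => -[eD hD]; split=> //.
  move=> x xD; have xa : bit a x by rewrite bit_godel_fset.
  have /allP/(_ x) := hD; rewrite mem_iota add0n bit_lt // xa => /(_ isT)/andP[].
  by rewrite !bit_godel_op_code => /eqP-> /eqP->.
apply/allP => x _; apply/implyP; rewrite bit_godel_fset => /hD[h1 h2].
by rewrite !bit_godel_op_code h1 h2 !eqxx.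
Qed.

Lemma godel_op_arith : partial_op_on D op -> arith_op a b.
Proof.
move=> hop; split=> [q /bit_godel_op[x [y [z [-> opz]]]]|x y z z'].
  have [xD yD zD] := hop _ _ _ opz.
  by exists x, y, z; rewrite eqxx !bit_godel_fset xD yD zD.
by rewrite !bit_godel_op_code => /eqP-> /eqP[->].
Qed.

Lemma arith_partial_op : arith_op a b -> partial_op_on D op.
Proof.
move=> [hop _] x y z opz.
have /hop[x' [y' [z' [/eqP/code_inj[<- <- <-]]]]] :
    bit b (CodeSeq.code [:: x; y; z]) by rewrite bit_godel_op_code opz.
by rewrite !bit_godel_fset => /and3P[].
Qed.

Lemma supp_sofic_arith_sofic p :
    (forall k, k \in D -> computes phi k (p k)) -> e \in D ->
    partial_op_on D op ->
    (forall r : R, (1 < r)%R -> supp_sofic_approx p r^-1%R) ->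
  arith_sofic phi a b e.
Proof.
move=> hp eD hop hs r.
have [|N [sigma [N_gt0 [_ sE] hexp [h1 hmul]]]] := hs r.+2%:R%R; first by rewrite ltr1n.
(* The table of all [sigma (p k)], with value 0 outside of ['I_N]. *)
pose s q := odflt 0 (omap (fun i : 'I_N => val (sigma (p (nfst q)) i)) (insub (nsnd q))).
(* Pairs with [k < a] and [i < N] have codes at most [npair a N]. *)
have [w hw] := entry_exists s (npair a N).+1.
have ew k (i : 'I_N) : bit a k -> entry w (npair k i) = sigma (p k) i.
  move=> /bit_lt ka; rewrite hw; last by rewrite ltnS leq_npair 1?ltnW.
  by rewrite /s nfst_npair nsnd_npair valK.
exists N, w; split=> //; split; [|split; [|split]].
- move=> k _ ka; split; [|split] => [i iN|i iN j jN ij|i iN].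
  + by rewrite (ew k (Ordinal iN)).
  + rewrite (ew k (Ordinal iN)) // (ew k (Ordinal jN)) //.
    by rewrite (inj_eq val_inj) (inj_eq perm_inj).
  + have kD : k \in D by rewrite -bit_godel_fset.
    exists (p k i.+1); split; first exact: hp.
    (* A value [y.+1] of [p k] with [y < N] is the point represented by [y], and there the
       supp-morphism condition applies. *)
    apply/implyP=> /andP[]; case def_y: (p k i.+1) => [//|y] _ yN.
    rewrite (ew k (Ordinal iN)) // eqSS; apply/eqP.
    by rewrite (sE (p k) _ _ (Ordinal yN)) //; exists k.
- move=> i iN; rewrite (ew e (Ordinal iN)) ?bit_godel_fset //.
  by rewrite [sigma (p e)]h1 perm1.
- move=> k _ l _ ka la kl; move: (hexp k l); rewrite dH_geE //= !bit_godel_fset in ka la *.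
  move=> /(_ ka la)/(_ (elimN eqP kl)); congr (_ * _ <= _); rewrite -card_ord_count.
  by apply: eq_card => i; rewrite !inE !ew ?bit_godel_fset // (inj_eq val_inj).
- move=> k _ l _ m _; rewrite bit_godel_op_code => /eqP klm.
  have [kD lD mD] := hop _ _ _ klm.
  move: (hmul k l m klm); rewrite dH_leE //=; congr (_ * _ <= _).
  rewrite -card_ord_count; apply: eq_card => i; rewrite !inE !ew ?bit_godel_fset //.
  by rewrite (inj_eq val_inj) /pmulS permM.
Qed.

Lemma arith_sofic_supp_sofic p (f : (nat -> nat) -> nat) :
    (forall k, k \in D -> computes phi k (p k)) -> e \in D -> p e = id ->
    (forall k, k \in D -> f (p k) = k) ->
    partial_op_on D op -> arith_sofic phi a b e ->
  forall r : R, (1 < r)%R -> supp_sofic_approx p r^-1%R.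
Proof.
move=> hp eD pe fp hop hs r r_gt1.
have r_gt0 : (0 < r)%R by apply: lt_trans r_gt1.
(* The threshold used is [(Num.bound r).+2], a natural number above [r]; its inverse gives stronger
   bounds. *)
have [N [w [N_gt0 [hperm [he [hexp hmul]]]]]] := hs (Num.bound r).
have rle : ((Num.bound r).+2%:R^-1 <= r^-1)%R.
  rewrite lef_pV2 ?posrE ?ltr0n //.
  by apply: le_trans (ltW (archi_boundP (ltW r_gt0))) _; rewrite ler_nat ltnW.
have /choice[t ht] : forall k, exists s : 'S_N,
    k \in D -> forall i, s i = entry w (npair k i) :> nat.
  move=> k; case: (boolP (k \in D)) => [kD|_]; last by exists 1%g.
  have ka : bit a k by rewrite bit_godel_fset.
  have [h1 [h2 _]] := hperm k (bit_lt ka) ka.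
  have [|s hs'] := @perm_of_nat_fun N (fun i => entry w (npair k i)) h1.
    by move=> i j iN jN; exact: h2.
  by exists s.
have lt_a k : k \in D -> k < a by rewrite -bit_godel_fset; exact: bit_lt.
have te : t e = 1%g.
  by apply/permP => i; apply/val_inj; rewrite perm1 /= ht // (eqP (he i _)).
(* [f] recovers the index of an element of the chunk, and [t] turns the row of that index into a
   permutation. *)
exists N, (fun rho => t (f rho)); split=> //.
- split; first by rewrite -pe fp.
  move=> _ [k /= kD <-] i j kij; rewrite fp //; apply/val_inj; rewrite /= ht //.
  have ka : bit a k by rewrite bit_godel_fset.
  have [_ [_ /(_ i (ltn_ord i))[y [hy]]]] := hperm k (lt_a k kD) ka.
  by rewrite (ev_functional hy (hp k kD i.+1)) kij /= ltn_ord => /eqP[].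
- move=> k l /= kD lD kl; rewrite !fp //; apply: (@le_trans _ _ (1 - (Num.bound r).+2%:R^-1)%R).
    by rewrite lerD2l lerN2.
  rewrite dH_geE //.
  have := hexp k (lt_a k kD) l (lt_a l lD); rewrite !bit_godel_fset.
  move=> /(_ kD lD)/(_ (introN eqP kl)); congr (_ * _ <= _); rewrite -card_ord_count.
  by apply: eq_card => i; rewrite !inE -!ht // (inj_eq val_inj).
- split; first by rewrite /= fp.
  move=> k l m /= klm; have [kD lD mD] := hop _ _ _ klm.
  rewrite !fp //; apply: le_trans rle; rewrite dH_leE //.
  have := hmul k (lt_a k kD) l (lt_a l lD) m (lt_a m mD).
  rewrite bit_godel_op_code klm => /(_ (eqxx _)); congr (_ * _ <= _).
  rewrite -card_ord_count; apply: eq_card => i; rewrite !inE -!ht //.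
  by rewrite (inj_eq val_inj) /pmulS permM.
Qed.

Lemma supp_sofic_arith :
  op_unit D op e -> supp_sofic_triple R phi D op n -> arith_triple phi a b n e.
Proof.
move=> [eD he] [g [p [f [e' [[gn gg gprof] [[hop [e'D he']] hp hchunk fp hreal] hs]]]]].
(* A unit is unique: the product of [e] and [e'] equals both. *)
have ee' : e' = e.
  by have [+ _] := he _ e'D; have [_ +] := he' _ eD; move=> -> [].
rewrite {}ee' {e' e'D he'} in hreal hs.
have [[[_ [k0 /= k0D pk0] Ebij] Ebnd] [[fid fhom] _]] := (hchunk, hreal).
(* The identity is some [p k0], and [f] sends it both to [k0] and to the unit [e]. *)
have pe : p e = id by rewrite /= -pk0 fp // in fid; rewrite -fid.
have pE k : k \in D -> [set p k | k in [set k | k \in D]]%classic (p k).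
  by move=> kD; exists k.
split; [|split; [|split; [|split]]].
- exact: godel_op_arith.
- split=> [x|r].
    by exists (g x), (g x.+1); split=> //; split=> //; apply/andP; exact: gg.
  have [N [m [gN hN]]] := (prof_finiteP R gg).1 gprof r.
  by exists N, m, (g m); split=> //; rewrite gN hN.
- split; [|split; [|split]].
  + move=> k x; rewrite bit_godel_fset => kD; exists (p k x), (g x).
    by split; [exact: hp | split=> //; exact: (Ebnd _ (pE k kD))].
  + move=> k x x'; rewrite bit_godel_fset => kD xx'; exists (p k x), (p k x').
    split; [exact: hp | split; first exact: hp].
    by rewrite (inj_eq (bij_inj (Ebij _ (pE k kD)))).
  + move=> k y; rewrite bit_godel_fset => kD; have [q _ qK] := Ebij _ (pE k kD).
    by exists (q y); have := hp k kD (q y); rewrite qK.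
  + by move=> x; have := hp e eD x; rewrite pe.
- split.
    move=> k l; rewrite !bit_godel_fset => kD lD kl.
    have /existsNP[x hx] : ~ forall x, p k x = p l x.
      by move=> /funext pkl; move/eqP: kl; apply; rewrite -(fp k) // pkl fp.
    by exists x, (p k x), (p l x); split; [exact: hp | split; [exact: hp | exact/eqP]].
  move=> k l m; rewrite !bit_godel_fset bit_godel_op_code => kD lD mD klm.
  have /existsNP[x hx] : ~ forall x, p m x = p k (p l x).
    move=> /funext pklm; move/eqP: klm; apply.
    have := fhom (p k) (p l) (p m); rewrite /= !fp //; apply.
    by split; [exact: pE | exact: pE | exact: pE |].
  exists x, (p l x), (p k (p l x)), (p m x).
  by do 3?[split; first exact: hp]; rewrite eq_sym; exact/eqP.
- exact: supp_sofic_arith_sofic hp eD hop hs.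
Qed.

(** Totality lets [g] and [p] be obtained by choice; by determinism every asserted value is then one
    of theirs, and the arithmetical clauses become statements about [g] and [p]. *)
Lemma arith_supp_sofic :
  op_unit D op e -> arith_triple phi a b n e -> supp_sofic_triple R phi D op n.
Proof.
move=> [eD he] [/arith_partial_op hop [[hg hprof] [[hbnd [hinj [hsurj hid]]]
  [[hdist hhom] hs]]]].
have /choice[g gn] : forall x, exists y, ev phi [tuple n; x] y.
  by move=> x; have [y [_ [+ _]]] := hg x; exists y.
have /choice[p hp] : forall k, exists h, k \in D -> computes phi k h.
  move=> k; case: (boolP (k \in D)) => [kD|_]; last by exists id.
  have /choice[h hh] : forall x, exists y, ev phi [tuple k; x] y.
    move=> x; have [|y [_ [+ _]]] := hbnd k x; first by rewrite bit_godel_fset.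
    by exists y.
  by exists h.
have pP k x y : k \in D -> ev phi [tuple k; x] y -> y = p k x.
  by move=> kD hy; apply: ev_functional hy (hp k kD x).
have gP x y : ev phi [tuple n; x] y -> y = g x.
  by move=> hy; apply: ev_functional hy (gn x).
have gg : growth_fun g.
  move=> x; have [y [y' [/gP-> [/gP-> /andP[]]]]] := hg x.
  by split.
have pe : p e = id by apply/funext => x; rewrite -(pP e x x eD (hid x)).
have p_inj k l : k \in D -> l \in D -> p k = p l -> k = l.
  move=> kD lD pkl; apply/eqP/negPn/negP => kl.
  have [||x [y [y' [/(pP _ _ _ kD)-> [/(pP _ _ _ lD)->]]]]] := hdist k l _ _ kl;
    rewrite ?bit_godel_fset //.
  by rewrite pkl eqxx.
(* [f] inverts [p] on the chunk, where [p_inj] makes the index unique; elsewhere it is arbitrary. *)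
have /choice[f fP] : forall rho, exists k', forall k, k \in D -> p k = rho -> k' = k.
  move=> rho; case: (pselect (exists2 k, k \in D & p k = rho)) => [[k kD <-]|nex].
    by exists k => l lD pl; apply: p_inj.
  by exists 0 => k kD pk; case: nex; exists k.
have fp k : k \in D -> f (p k) = k by move=> kD; exact: fP.
have fid : f id = e by rewrite -pe fp.
exists g, p, f, e; split; last exact: arith_sofic_supp_sofic hp eD pe fp hop hs.
  split=> //; apply/prof_finiteP => // r.
  by have [N [m [y [/gP-> /andP[]]]]] := hprof r; exists N, m.
have g_mono x y : x <= y -> g x <= g y.
  by move=> xy; apply: (homo_leq leqnn leq_trans _ xy) => i; have [] := gg i.
split=> //.
- split; last first.
    move=> _ [k /= kD <-] x m mx; apply: leq_trans (g_mono _ _ mx).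
    have [|y [z [/(pP _ _ _ kD)-> [/gP->]]]] := hbnd k m; first by rewrite bit_godel_fset.
    by [].
  split.
  + by apply: finite_image; apply: finite_fset.
  + by exists e.
  + move=> _ [k /= kD <-].
    have ka : bit a k by rewrite bit_godel_fset.
    have /choice[q hq] := fun y => hsurj k y ka.
    (* Surjectivity yields a right inverse [q], and injectivity makes it two-sided. *)
    have qK : cancel q (p k) by move=> y; rewrite -(pP k _ y).
    exists q => //; apply: inj_can_sym qK _ => x x' pxx'.
    apply/eqP/negPn/negP => /(hinj k _ _ ka)[y [y' [/(pP _ _ _ kD)-> [/(pP _ _ _ kD)->]]]].
    by rewrite pxx' eqxx.
- split; first split=> //.
    move=> rho tau pi /= [[k /= kD <-] [l /= lD <-] [m /= mD <-] pklm].
    rewrite !fp //; apply/eqP; rewrite -bit_godel_op_code; apply/negPn/negP => klm.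
    have [|||x [y [z [u [/(pP _ _ _ lD)-> [/(pP _ _ _ kD)-> [/(pP _ _ _ mD)->]]]]]]] :=
      hhom k l m _ _ _ klm; rewrite ?bit_godel_fset //.
    by rewrite pklm eqxx.
  split.
  + by move=> _ [k /= kD <-]; rewrite /= fp.
  + by move=> _ _ /set_mem[k /= kD <-] /set_mem[l /= lD <-]; rewrite !fp // => ->.
  + by move=> k /= kD; exists (p k); [exists k | rewrite fp].
Qed.

End Equivalence.

(** * Completeness *)

(** The one-element chunk satisfies (ii) and (iii) regardless of [n], so only the totality of
    [phi_n] will carry information in the reduction. *)
Lemma trivial_supp_sofic (R : realType) (phi : recf 2) (k n : nat) :
    computes phi k id -> computes phi n succn ->
  supp_sofic_triple R phi [fset k]%fset [fmap].[(k, k) <- k]%fmap n.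
Proof.
move=> hk hn.
have opE x y z : ([fmap].[(k, k) <- k].[? (x, y)])%fmap = Some z ->
    [/\ x = k, y = k & z = k].
  by rewrite fnd_set; case: eqP => [[-> ->] [<-]|_]; rewrite ?fnd_fmap0.
exists succn, (fun=> id), (fun=> k), k; split.
- split=> //; apply/prof_finiteP => // r.
  (* [N = r + 2] is the successor of [m = r + 1], and [N - m = 1]. *)
  by exists r.+2, r.+1; rewrite subSnn mul1n.
- split=> //.
  + split; first by move=> x y z /opE[-> -> ->]; rewrite inE.
    by split=> [|x]; rewrite inE // => /eqP->; rewrite fnd_set eqxx.
  + by move=> k'; rewrite inE => /eqP->.
  + split; last by move=> _ [k' _ <-] x m; exact: leqW.
    split; first by apply: finite_image; apply: finite_fset.
    * by exists k => //=; rewrite inE.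
    * by move=> _ [k' _ <-]; exists id.
  + by move=> k'; rewrite inE => /eqP.
  + split; first by split=> // rho tau pi /= _; rewrite fnd_set eqxx.
    split=> [rho _|rho tau /set_mem[k1 _ <-] /set_mem[k2 _ <-]|k'] //=.
      by rewrite inE.
    by rewrite inE => /eqP->; exists id => //; exists k => //=; rewrite inE.
(* [S_1] serves every threshold; expansiveness is vacuous as there is one element. *)
- move=> r r_gt1; exists 1, (fun=> 1%g); split=> //.
  + split=> // _ [k' _ <-] i j [ij]; rewrite perm1; exact/val_inj.
  + by move=> x y /=; rewrite !inE => /eqP-> /eqP->.
  + split=> // x y z _; rewrite dH_disagree // eq_card0 ?mul0r.
      by rewrite invr_ge0 (le_trans ler01 (ltW r_gt1)).
    by move=> i; rewrite inE /= /pmulS mulg1 eqxx.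
Qed.

(** An unbounded search for a witness is composed with the successor, which restricts the domain but
    leaves the values alone. *)
Lemma domain_restricted_succ (Q : nat -> nat -> nat -> bool) :
    computable_rel3 Q ->
  exists c : recf 2, forall x y z,
    ev c [tuple x; y] z <-> (exists w, Q x y w) /\ z = y.+1.
Proof.
move=> [c hc].
(* [RMu] searches for a zero in argument 0, hence [1 - Q] with the witness variable moved to the
   front. *)
have [d hd] : cfun 3 (fun v => 1 - Q (nth 0 v 1) (nth 0 v 2) (nth 0 v 0)).
  apply: cfun_sub; first exact: cfun_const.
  apply: (@cfun_comp 3 (fun v => Q (nth 0 v 0) (nth 0 v 1) (nth 0 v 2))
    [:: nth 0 ^~ 1; nth 0 ^~ 2; nth 0 ^~ 0]).
    exists c => v; have := hc (nth 0 v 0) (nth 0 v 1) (nth 0 v 2).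
    rewrite (_ : [tuple _; _; _] = v) //; apply: val_inj.
    by case: v => -[|? [|? [|? []]]].
  by case=> [|[|[|i]]] // _; apply: cfun_proj.
have hmu x y : (exists w, ev (RMu d) [tuple x; y] w) <-> exists w, Q x y w.
  have hdv w b : ev d (cons_tuple w [tuple x; y]) b <-> b = 1 - Q x y w.
    by split=> [|->]; [move/ev_functional; apply|]; exact: (hd (cons_tuple w [tuple x; y])).
  split=> [[w [/hdv hw _]]|exQ]; first by exists w; case: (Q x y w) hw.
  (* Minimization needs nonzero values below the result, so the least witness is taken. *)
  exists (ex_minn exQ); case: ex_minnP => w Qw minw; split; first by apply/hdv; rewrite Qw.
  move=> i lt_iw; exists 0; apply/hdv; case Qi: (Q x y i) => //.
  by have := minw i Qi; rewrite leqNgt lt_iw.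
have [t ht] : cfun 2 (fun v => (nth 0 v 1).+1).
  by apply: cfun_succ; apply: cfun_proj.
(* [t] ignores its first argument, but composition requires the search that computes it to
   succeed. *)
exists (RComp t (fun i : 'I_2 => if i == ord0 then RMu d else RProj ord_max)).
move=> x y z; rewrite -hmu; split=> [[w [hw /ev_functional tw]]|[[u hu] ->]].
  split; first by exists (tnth w ord0); exact: (hw ord0).
  rewrite (tw _ (ht w)) /=; congr _.+1.
  by have := hw ord_max; rewrite /= !(tnth_nth 0).
exists [tuple u; y]; split; last exact: (ht [tuple u; y]).
move=> i; case: (unliftP ord0 i) => [j|] -> //=.
by rewrite (ord1 j) !(tnth_nth 0).
Qed.

Theorem theorem3p2 (R : realType) (phi : recf 2) (phi_universal : universal phi) :
  Pi02_complete
    (fun c : nat => exists (D : {fset nat}) (op : {fmap nat * nat -> nat}) (n : nat),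
       c = godel_triple D op n /\ supp_sofic_triple R phi D op n).
Proof.
split.
  apply: cPi02_Pi02; apply: (cPi02_arith (phi := phi)) => c; split.
    move=> [D [op [n [-> hs]]]]; split.
      have [g [p [f [e [_ [[_ he] _ _ _ _] _]]]]] := hs.
      exists (godel_fset D), (godel_op op), n, e; rewrite eqxx; split=> //.
      exact/arith_unitP.
    move=> a b n' e /eqP/code_inj[<- <- <-] /arith_unitP he.
    exact: supp_sofic_arith hs.
  move=> [[a [b [n [e [/eqP -> he]]]]] /(_ a b n e (eqxx _) he) ht].
  have [[hop1 hop2] _] := ht.
  (* Surjectivity of the canonical indices turns the numbers back into a set and an operation. *)
  have [D eD] := godel_fset_surj a.
  have [||op eop] := @godel_op_surj b.
  - by move=> q /hop1[x [y [z [/eqP-> _]]]]; exists x, y, z.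
  - by move=> x y z z' h h'; apply/eqP; exact: hop2 h h'.
  exists D, op, n; rewrite /godel_triple eD eop; split=> //.
  rewrite -eD -eop in he ht.
  apply: arith_supp_sofic ht; exact/arith_unitP.
move=> B [Q cQ hB].
(* Universality applied to the second projection supplies an index [s0 0] of the identity. *)
have [idc hid] : cfun 2 (fun v => nth 0 v 1) by exact: cfun_proj.
have [s0 _ hs0] := phi_universal idc.
have hk : computes phi (s0 0) id by move=> y; apply/hs0; exact: (hid [tuple 0; y]).
have [c hc] := domain_restricted_succ cQ.
have [s /computable_funP cs hs] := phi_universal c.
pose k := s0 0.
(* Set and operation are constant; [x] enters only through the index [s x]. *)
exists (fun x => godel_triple [fset k]%fset [fmap].[(k, k) <- k]%fmap (s x)).
  by apply/computable_funP; rewrite /godel_triple; computable_tac.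
move=> x; rewrite hB; split=> [hQ|].
  exists [fset k]%fset, [fmap].[(k, k) <- k]%fmap, (s x); split=> //.
  by apply: trivial_supp_sofic => // y; apply/hs/hc; split.
(* Injectivity of the code forces [n = s x]; totality of this function already yields a witness for
   each [y]. *)
move=> [D [op [n [/code_inj[_ _ <-]]]]] [g [_ [_ [_ [[gn _ _] _ _]]]]] y.
by have /hs/hc[] := gn y.
Qed.
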